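(* If $\Delta$ is a simplicial complex of subsets of $\{1,\dots,n\}$ with three or fewer facets, then $I_\Delta$ is a radical ideal of $R$.
   Context: $\mathbb K$ is a field, $R=\mathbb K[x_{i_1,\dots,i_n}:1\le i_j\le a_j]$, $A=(x_{i_1,\dots,i_n})$ the generic $a_1\times\dots\times a_n$ table. For a tuple $\sigma$ with $\sigma_j\in\{1,\dots,a_j\}\cup\{+\}$, $x_\sigma$ is the sum of all $x_{i_1,\dots,i_n}$ with $i_j=\sigma_j$ whenever $\sigma_j\ne+$. For $\mathscr J=\{j_1<\dots<j_m\}$ the margin $A_{\mathscr J}$ is the table whose $(i_1,\dots,i_m)$ entry is $x_\sigma$ with $\sigma_{j_r}=i_r$, $\sigma_j=+$ for $j\notin\mathscr J$. For a table $B$ with entries in $R$, $I(B)$ is the ideal generated by its generalized $2\times2$ minors $\det\begin{pmatrix} b_{i_1,\dots,i_m} & b_{j_1,\dots,j_{l-1},i_l,j_{l+1},\dots,j_m}\\ b_{i_1,\dots,i_{l-1},j_l,i_{l+1},\dots,i_m} & b_{j_1,\dots,j_m}\end{pmatrix}$, and $I_\Delta=\sum_{\mathscr J\in\Delta}I(A_{\mathscr J})$. A simplicial complex is a nonempty family of subsets closed under subsets; facets are its maximal elements. *)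

(* Defs.v *)
From HB Require Import structures.
From mathcomp Require Import all_boot all_order all_algebra.
From mathcomp Require Import mpoly.
Set Implicit Arguments. Unset Strict Implicit. Unset Printing Implicit Defensive.
Import GRing.Theory.
Local Open Scope ring_scope.

(* Cells of the generic a_1 x ... x a_n table: tuples (i_1,...,i_n) with
   i_j in 'I_(a j)  (0-based instead of 1-based). *)
Definition cell (n : nat) (a : 'I_n -> nat) : finType :=
  {dffun forall j : 'I_n, 'I_(a j)}.

Definition polyR (K : fieldType) (n : nat) (a : 'I_n -> nat) :=
  {mpoly K[#|cell a|]}.

Definition xvar (K : fieldType) (n : nat) (a : 'I_n -> nat) (c : cell a)
  : polyR K a := 'X_(enum_rank c).

(* Entry of the margin A_J at the J-coordinates of u :
   x_sigma with sigma_j = u j for j in J and sigma_j = + otherwise. *)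
Definition margin (K : fieldType) (n : nat) (a : 'I_n -> nat)
  (J : {set 'I_n}) (u : cell a) : polyR K a :=
  \sum_(c : cell a | [forall j in J, c j == u j]) xvar K c.

Definition swap_coord (n : nat) (a : 'I_n -> nat) (l : 'I_n) (u v : cell a)
  : cell a :=
  @finfun 'I_n (fun j => 'I_(a j)) (fun k => if k == l then u k else v k).

Definition margin_minor (K : fieldType) (n : nat) (a : 'I_n -> nat)
  (J : {set 'I_n}) (p : polyR K a) : Prop :=
  exists (u v : cell a) (l : 'I_n), l \in J /\
    p = margin K J u * margin K J v
        - margin K J (swap_coord l u v) * margin K J (swap_coord l v u).

Definition ideal_gen (R : comNzRingType) (S : R -> Prop) (f : R) : Prop :=
  exists s : seq (R * R),
    (forall q, q \in s -> S q.2) /\ f = \sum_(q <- s) q.1 * q.2.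

Definition radical_ideal (R : comNzRingType) (S : R -> Prop) : Prop :=
  forall (f : R) (k : nat), ideal_gen S (f ^+ k) -> ideal_gen S f.

(* Generators of I_Delta = sum over J in Delta of I(A_J). *)
Definition IDelta_gens (K : fieldType) (n : nat) (a : 'I_n -> nat)
  (Delta : {set {set 'I_n}}) (p : polyR K a) : Prop :=
  exists2 J, J \in Delta & margin_minor J p.

Definition simplicial_complex (n : nat) (Delta : {set {set 'I_n}}) : Prop :=
  Delta != set0 /\
  forall F G : {set 'I_n}, F \in Delta -> G \subset F -> G \in Delta.

Definition facets (n : nat) (Delta : {set {set 'I_n}}) : {set {set 'I_n}} :=
  [set F in Delta | [forall G in Delta, (F \subset G) ==> (G == F)]].

(* Main.v *)
(** After fixing a base cell [z], the margins of the cells supported in a facet become new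
coordinates, and I_Delta becomes the ideal generated by the moves exchanging one entry between
two cells whose supports lie in a common facet.  It is a pure-difference binomial ideal, so
radicality is a statement about the congruence [eqv] on multisets of cells.

Sort the facets into blocks: all separate, one isolated from the two others, or all together.
Take the finest partition such that two facets X and Y in different blocks are kept apart by an
entry in X but not in Y that never vanishes on the block of X.  With at most three facets,
maximality forces each nonempty block to reach a cell supported in all of its facets; such a
core cell is a buffer through which the other cells of the block exchange entries, so the number
of occurrences of each entry in each block determines the multiset up to moves.  These numbers
are the exponents of a monomial map which vanishes on the ideal, and the maps obtained from all
partitions separate the classes of [eqv]; since their targets are domains, the ideal is
radical. *)
From HB Require Import structures.
Require Import Defs.
From mathcomp Require Import all_boot all_order all_algebra.
From mathcomp Require Import mpoly.
Set Implicit Arguments. Unset Strict Implicit. Unset Printing Implicit Defensive.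

(** * Cells, supports and the congruence generated by moves *)

Section Cells.

Variables (n : nat) (a : 'I_n -> nat) (z : cell a).
Implicit Types (c d u v : cell a) (s t r : seq (cell a)) (X P : {set 'I_n}).
Implicit Types (F : 'I_3 -> {set 'I_n}) (i j : 'I_n).

Definition supp c : {set 'I_n} := [set j | c j != z j].

Lemma suppP c X : reflect (forall j, j \notin X -> c j = z j) (supp c \subset X).
Proof.
apply: (iffP subsetP) => [h j jX | h j].
  by apply/eqP; apply: contraNT jX => cj; apply: h; rewrite inE.
by rewrite inE; apply: contraNT => /h ->.
Qed.

Lemma supp_mem c X j : supp c \subset X -> c j != z j -> j \in X.
Proof. by move=> /suppP h; apply: contraNT => /h ->. Qed.

Lemma swap_coordE l u v k : swap_coord l u v k = if k == l then u k else v k.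
Proof. by rewrite /swap_coord ffunE. Qed.

Lemma swap_coordC l u v : swap_coord l (swap_coord l u v) (swap_coord l v u) = u.
Proof. by apply/ffunP=> k; rewrite !swap_coordE; case: eqP. Qed.

Lemma swap_coord_id l u v : u l = v l -> swap_coord l u v = v.
Proof. by move=> e; apply/ffunP=> k; rewrite swap_coordE; case: eqP => // ->. Qed.

Lemma supp_swap l u v X :
  supp v \subset X -> (u l != z l -> l \in X) -> supp (swap_coord l u v) \subset X.
Proof.
move=> /suppP hv hu; apply/suppP => k kX; rewrite swap_coordE.
case: eqP => [ek|_]; last exact: hv.
by apply/eqP; apply: contraNT kX; rewrite ek => /hu.
Qed.

Lemma supp_swap2 l u v X :
  supp u \subset X -> supp v \subset X -> supp (swap_coord l u v) \subset X.
Proof. by move=> hu hv; apply: supp_swap => // /(supp_mem hu). Qed.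

(** Multisets are lists up to [EqvPerm]; the common tail [s] of a move makes this a congruence. *)
Inductive eqv F : seq (cell a) -> seq (cell a) -> Prop :=
| EqvPerm s t of perm_eq s t : eqv F s t
| EqvMove k l u v s of supp u \subset F k & supp v \subset F k & l \in F k :
    eqv F (u :: v :: s) (swap_coord l u v :: swap_coord l v u :: s)
| EqvSym s t of eqv F s t : eqv F t s
| EqvTrans s t r of eqv F s t & eqv F t r : eqv F s r.

Definition valid F c := [exists k, supp c \subset F k].
Definition core F c := [forall k, supp c \subset F k].

Lemma validP F c : reflect (exists k, supp c \subset F k) (valid F c).
Proof. exact: existsP. Qed.

Lemma coreP F c : reflect (forall k, supp c \subset F k) (core F c).
Proof. exact: forallP. Qed.

Lemma core_valid F c : core F c -> valid F c.
Proof. by move=> /coreP h; apply/validP; exists ord0. Qed.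

Lemma eqvxx F s : eqv F s s. Proof. exact: EqvPerm. Qed.

Lemma eqv_catr F s t r : eqv F s t -> eqv F (s ++ r) (t ++ r).
Proof.
elim=> [{}s {}t st|k l u v {}s hu hv hl|{}s {}t _|s1 s2 s3 _ h1 _ h2].
- by apply: EqvPerm; rewrite perm_cat2r.
- exact: (EqvMove _ hu hv hl).
- exact: EqvSym.
- exact: EqvTrans h1 h2.
Qed.

Lemma eqv_catl F s t r : eqv F s t -> eqv F (r ++ s) (r ++ t).
Proof.
move=> /(eqv_catr r) h; apply: EqvTrans (EqvPerm _ _) _; first by rewrite perm_catC.
by apply: EqvTrans h (EqvPerm _ _); rewrite perm_catC.
Qed.

Lemma eqv_cat F s t s' t' : eqv F s t -> eqv F s' t' -> eqv F (s ++ s') (t ++ t').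
Proof. by move=> h h'; apply: EqvTrans (eqv_catr _ h) (eqv_catl _ h'). Qed.

Lemma eqv_cons F c s t : eqv F s t -> eqv F (c :: s) (c :: t).
Proof. exact: (@eqv_catl _ _ _ [:: c]). Qed.

Lemma eqv_sub F F' s t : (forall k, exists k', F k \subset F' k') ->
  eqv F s t -> eqv F' s t.
Proof.
move=> FF'; elim=> [{}s {}t st|k l u v {}s hu hv hl|{}s {}t _|s1 s2 s3 _ h1 _ h2].
- exact: EqvPerm.
- have [k' /[dup] /subsetP sl sk] := FF' k.
  by apply: (EqvMove (k := k')); [apply: subset_trans sk|apply: subset_trans sk|apply: sl].
- exact: EqvSym.
- exact: EqvTrans h1 h2.
Qed.

Lemma eqv_count F s t j w : eqv F s t ->
  count (fun c => c j == w) s = count (fun c => c j == w) t.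
Proof.
elim=> [{}s {}t /permP ->//|k l u v {}s _ _ _|//|s1 s2 s3 _ -> _ ->//].
by rewrite /= !swap_coordE; case: (j == l) => //; rewrite addnCA.
Qed.

Lemma eqv_size F s t : eqv F s t -> size s = size t.
Proof.
by elim=> [{}s {}t /perm_size|k l u v {}s _ _ _|{}s {}t _ ->|s1 s2 s3 _ -> _ ->].
Qed.

Lemma eqv_all F (p : pred (cell a)) s t :
  (forall k l u v, supp u \subset F k -> supp v \subset F k ->
    p u && p v = p (swap_coord l u v) && p (swap_coord l v u)) ->
  eqv F s t -> all p s = all p t.
Proof.
move=> hp; elim=> [{}s {}t /perm_all ->//|k l u v {}s hu hv _|//|s1 s2 s3 _ -> _ ->//].
by rewrite /= !andbA; congr andb; apply: hp hu hv.
Qed.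

Lemma eqv_valid F s t : eqv F s t -> all (valid F) s = all (valid F) t.
Proof.
have sw k l u v : supp u \subset F k -> supp v \subset F k ->
    valid F u && valid F (swap_coord l u v).
  by move=> hu hv; apply/andP; split; apply/validP; exists k; rewrite ?supp_swap2.
apply: eqv_all => k l u v hu hv.
case/andP: (sw k l u v hu hv) => -> ->.
by case/andP: (sw k l v u hv hu) => -> ->.
Qed.

(** At a coordinate outside [F k] both cells have the base entry, so the exchange is trivial
    there. *)
Lemma eqv_exch F k l u v s : supp u \subset F k -> supp v \subset F k ->
  eqv F (u :: v :: s) (swap_coord l v u :: swap_coord l u v :: s).
Proof.
move=> hu hv; have [lk|lk] := boolP (l \in F k).
  apply: EqvTrans (EqvPerm _ _) (EqvMove _ hv hu lk).
  by rewrite (perm_catCA [:: u] [:: v]).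
have e : u l = v l by move/suppP: hu => ->; first move/suppP: hv => ->.
by rewrite !swap_coord_id //; exact: eqvxx.
Qed.

(* The core cell [c0] serves as a buffer, carrying the [l]-th entry of [u] from facet [k] to
   facet [m]. *)
Lemma eqv_core_exch F k m l c0 u v s : core F c0 ->
  supp u \subset F k -> supp v \subset F m -> l \in F k -> l \in F m ->
  eqv F (c0 :: u :: v :: s) (c0 :: swap_coord l v u :: swap_coord l u v :: s).
Proof.
move=> /coreP h0 hu hv lk lm.
apply: EqvTrans (eqv_exch l _ (h0 k) hu) _.
set c1 := swap_coord l u c0; set u1 := swap_coord l c0 u.
have c1m : supp c1 \subset F m by apply: supp_swap.
apply: (@EqvTrans _ _ (u1 :: c1 :: v :: s)).
  by apply: EqvPerm; rewrite (perm_catCA [:: _] [:: _]).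
apply: EqvTrans (eqv_cons u1 (eqv_exch l _ c1m hv)) _.
set c2 := swap_coord l v c1; set v1 := swap_coord l c1 v.
have c2k : supp c2 \subset F k.
  by apply: supp_swap => //; apply: supp_swap => //; apply: h0.
have u1k : supp u1 \subset F k by apply: supp_swap.
apply: EqvTrans (eqv_exch l _ u1k c2k) _.
have -> : swap_coord l u1 c2 = c0.
  by apply/ffunP=> x; rewrite !swap_coordE; case: eqP.
have -> : swap_coord l c2 u1 = swap_coord l v u.
  by apply/ffunP=> x; rewrite !swap_coordE; case: eqP.
have -> : v1 = swap_coord l u v.
  by apply/ffunP=> x; rewrite !swap_coordE; case: eqP.
by apply: EqvPerm; rewrite (perm_catCA [:: _] [:: _]).
Qed.

(** A core cell shares a facet with every valid cell, so it can fetch the base entry at one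
    coordinate of [P] after another. Each exchange shrinks its support, hence it stays core. *)
Lemma eqv_gather F P c s : core F c -> all (valid F) s ->
  (forall l, l \in P -> has (fun c' => c' l == z l) (c :: s)) ->
  exists t, eqv F (c :: s) (finfun (fun l => if l \in P then z l else c l) :: t).
Proof.
have [m] := ubnP #|supp c :&: P|; elim: m c s => // m IH c s lem cc vs hP.
have [/setP e0|[l]] := set_0Vmem (supp c :&: P).
  exists s; rewrite (_ : finfun _ = c); first exact: eqvxx.
  apply/ffunP=> l; rewrite ffunE; case: ifP => // lP.
  by move: (e0 l); rewrite !inE lP andbT => /negbFE/eqP.
rewrite !inE => /andP[cl lP].
have /hasP[c'] := hP l lP; rewrite inE => /orP[/eqP->|c's /eqP c'l].
  by rewrite (negPf cl).
have /validP[k c'k] := allP vs _ c's.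
have ck := coreP _ _ cc k.
set c1 := swap_coord l c' c; set c2 := swap_coord l c c'.
have h1 : eqv F (c :: s) (c1 :: c2 :: rem c' s).
  apply: EqvTrans (eqv_exch l _ ck c'k).
  by apply: EqvPerm; rewrite perm_cons perm_to_rem.
have [|||l' l'P|t ht] := IH c1 (c2 :: rem c' s).
- rewrite -ltnS (leq_trans _ lem) // ltnS proper_card //.
  apply/properP; split; last first.
    by exists l; rewrite !inE ?lP ?swap_coordE ?eqxx ?c'l ?eqxx // cl.
  apply/subsetP=> x; rewrite !inE swap_coordE.
    by have [->|] := eqVneq x l; rewrite ?c'l ?eqxx.
- by apply/coreP=> k'; apply: supp_swap; [exact: (coreP _ _ cc)|rewrite c'l eqxx].
- have := eqv_valid h1; rewrite /= vs (core_valid cc) /=.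
  by case: (valid F c1) => //= <-.
- by have := hP l' l'P; rewrite !has_count (eqv_count _ h1).
exists t; apply: EqvTrans h1 _.
rewrite (_ : finfun _ = finfun (fun l0 => if l0 \in P then z l0 else c1 l0)) //.
apply/ffunP=> x; rewrite !ffunE; case: ifP => // xP.
by case: eqP => // ex; rewrite ex lP in xP.
Qed.

(** The entries of [d] are fetched one at a time, from the core cell or through it. By the last
    hypothesis only non-base entries have to be fetched, so the coordinate lies in the facets of
    both cells involved. *)
Lemma eqv_fill F k (d : cell a) c0 c s : core F c0 -> all (valid F) s ->
  supp c \subset F k -> supp d \subset F k ->
  (forall j, j \in F k -> has (fun c' => c' j == d j) (c0 :: c :: s)) ->
  (forall j, j \in F k -> d j = z j -> all (fun c' => c' j == z j) (c0 :: c :: s)) ->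
  exists c1 t, core F c1 /\ eqv F (c0 :: c :: s) (c1 :: d :: t).
Proof.
have [m] := ubnP #|[set j | c j != d j]|.
elim: m c0 c s => // m IH c0 c s lem cc vs ck dk hex hall.
have [/setP e0|[l]] := set_0Vmem [set j | c j != d j].
  exists c0, s; split=> //; rewrite (_ : d = c); first exact: eqvxx.
  by apply/ffunP=> l; move: (e0 l); rewrite !inE => /negbFE/eqP ->.
rewrite !inE => cl.
have lk : l \in F k.
  apply: contraNT cl => lk.
  by move/suppP: ck => -> //; move/suppP: dk => ->.
have dl : d l != z l.
  apply: contra_neq cl => dl; have := hall l lk dl.
  by rewrite /= dl => /and3P[_ /eqP].
have step c0' c' s' : core F c0' -> c' l = d l ->
    eqv F (c0 :: c :: s) (c0' :: swap_coord l c' c :: s') ->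
  exists c1 t, core F c1 /\ eqv F (c0 :: c :: s) (c1 :: d :: t).
  move=> cc' c'l h1.
  have [|||||j jk|j jk dj|c1 [t [h2 h3]]] := IH c0' (swap_coord l c' c) s'.
  - rewrite -ltnS (leq_trans _ lem) // ltnS proper_card //.
    apply/properP; split; last first.
      by exists l; rewrite !inE ?swap_coordE ?eqxx ?c'l ?eqxx // cl.
    apply/subsetP=> x; rewrite !inE swap_coordE.
    by have [->|] := eqVneq x l; rewrite ?c'l ?eqxx.
  - by [].
  - have vc : valid F c by apply/validP; exists k.
    have := eqv_valid h1; rewrite /= vs vc (core_valid cc) (core_valid cc') /=.
    by move/esym/andP=> [].
  - by apply: supp_swap.
  - by [].
  - by have := hex j jk; rewrite !has_count (eqv_count _ h1).
  - by have := hall j jk dj; rewrite !all_count (eqv_count _ h1) (eqv_size h1).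
  - by exists c1, t; split=> //; apply: EqvTrans h1 h3.
have /hasP[c'] := hex l lk; rewrite !inE => /or3P[/eqP->|/eqP->|c's] /eqP c'l.
(* The entry of [c0] at [l] is not the base one, so [l] lies in every facet and [c0] stays core
   whatever it receives there. *)
- apply: (step (swap_coord l c c0) c0 s) => //.
    by apply/coreP=> k'; apply: supp_swap => [|_];
      [exact: (coreP _ _ cc)|apply: supp_mem (coreP _ _ cc k') _; rewrite c'l].
  exact: eqv_exch (coreP _ _ cc k) ck.
- by rewrite c'l eqxx in cl.
- have /validP[k' c'k'] := allP vs _ c's.
  apply: (step c0 c' (swap_coord l c c' :: rem c' s)) => //.
  have := @eqv_core_exch _ k k' l _ _ _ (rem c' s) cc ck c'k' lk.
  move=> /(_ (supp_mem c'k' _)); rewrite c'l => /(_ dl).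
  by apply: EqvTrans; apply: EqvPerm; rewrite !perm_cons perm_to_rem.
Qed.

(** * Connectedness in the presence of a core cell *)

Lemma ord3_cases (k1 k2 k3 k : 'I_3) : k1 != k2 -> k1 != k3 -> k2 != k3 ->
  [|| k == k1, k == k2 | k == k3].
Proof.
move=> h12 h13 h23; have /setP/(_ k) : [set k1; k2; k3] = setT.
  apply/eqP; rewrite eqEcard subsetT cardsT card_ord -setUA cardsU1 cards2 !inE.
  by rewrite negb_or h12 h13 h23.
by rewrite !inE -orbA.
Qed.

Definition private F k j := [forall k', (k' != k) ==> (j \notin F k')].

(* Whether a cell in facet [k], apart from the core cell, can be reached from [s] is read off
   the numbers of entries in two sufficient cases: [private_used] and [roomy]. *)
Definition private_used F k s :=
  [exists j, private F k j && has (fun c => c j != z j) s].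

Definition roomy F k s :=
  [forall k', forall j, private F k' j ==> all (fun c => c j == z j) s]
  && [forall j, (j \notin F k) ==> (1 < count (fun c => c j == z j) s)].

(** A non-base entry at a coordinate private to [k] marks a cell of [F k]. In the roomy case a cell
    sheds its non-base entries outside [F k] in exchange for base entries of cells other than the
    core one. *)
Lemma eqv_extract F k s : all (valid F) s -> has (core F) s -> 1 < size s ->
  private_used F k s || roomy F k s ->
  exists c0 c t, [/\ eqv F s (c0 :: c :: t), core F c0 & supp c \subset F k].
Proof.
move=> vs /hasP[c0 c0s cc] szs.
have hs := EqvPerm F (perm_to_rem c0s).
have vs' : all (valid F) (rem c0 s).
  by have := eqv_valid hs; rewrite vs /= => /esym/andP[].
have found c : c \in rem c0 s -> supp c \subset F k ->
  exists c0 c t, [/\ eqv F s (c0 :: c :: t), core F c0 & supp c \subset F k].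
  move=> cs ck; exists c0, c, (rem c (rem c0 s)); split=> //.
  by apply: EqvTrans hs (EqvPerm _ _); rewrite perm_cons perm_to_rem.
case/orP=> [/existsP[j /andP[/forallP pj]]|/andP[/forallP pz /forallP room]].
  have /perm_has -> := perm_to_rem c0s; move=> /= /orP[c0j|/hasP[c cs cj]].
    (* The core cell is supported in the facets of the other indices too, so it cannot carry such an
       entry. *)
    have {}pj k' : k' != k -> False.
      move=> k'k; have := pj k'; rewrite k'k /= => /negP; apply.
      exact: supp_mem (coreP _ _ cc k') c0j.
    by case: (eqVneq ord0 k) pj => [<- /(_ ord_max isT)|h /(_ _ h)].
  have /validP[k' ck'] := allP vs' _ cs.
  apply: found cs _; have [<- //|k'k] := eqVneq k' k.
  by have := pj k'; rewrite k'k /= (supp_mem ck' cj).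
case: (rem c0 s) (perm_size (perm_to_rem c0s)) hs vs' => [/= e|c t _]; first by rewrite e in szs.
move=> {found}; have [m] := ubnP #|supp c :\: F k|.
elim: m c0 cc c t {c0s} => // m IH c0 cc c t lem hs vs'.
have [/hasP[c1 c1t c1k]|/hasPn nk] := boolP (has (fun c1 => supp c1 \subset F k) (c :: t)).
  exists c0, c1, (rem c1 (c :: t)); split=> //.
  by apply: EqvTrans hs (EqvPerm _ _); rewrite perm_cons perm_to_rem.
have /subsetPn[l lc lk] := nk c (mem_head _ _).
have {}lc : c l != z l by rewrite inE in lc.
have c0l : c0 l = z l by move/suppP: (coreP _ _ cc k) => ->.
have : 1 < count (fun c => c l == z l) s by move: (room l); rewrite lk.
rewrite (eqv_count _ hs) /= c0l eqxx (negPf lc) !add0n add1n ltnS -has_count.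
move=> /hasP[c' c't /eqP c'l].
have /validP[w cw] := allP vs' _ (mem_head _ _).
have /validP[y c'y] : valid F c' by apply: (allP vs'); rewrite inE c't orbT.
have lw := supp_mem cw lc.
have wk : w != k by apply: contraNneq lk => <-.
have yk : y != k.
  by apply: contraTneq c'y => ->; apply: nk; rewrite inE c't orbT.
have ly : l \in F y.
  have [-> //|yw] := eqVneq y w.
  apply: contraTT lc => ly; rewrite negbK.
  (* Were [l] outside [F y], it would avoid every facet but [F w], since [k], [w] and [y] exhaust
     the indices; but private coordinates carry only base entries here. *)
  have : private F w l.
    apply/forallP=> k'; apply/implyP=> k'w.
    by case/or3P: (@ord3_cases y w k k' yw yk wk) k'w => /eqP-> // /eqP.
  move: (forallP (pz w) l) => /implyP h /h.
  by rewrite all_count (eqv_count _ hs) (eqv_size hs) -all_count => /and3P[].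
have h1 : eqv F s (c0 :: swap_coord l c' c :: swap_coord l c c' :: rem c' t).
  apply: EqvTrans hs _; apply: EqvTrans (eqv_core_exch _ cc cw c'y lw ly).
  by apply: EqvPerm; rewrite !perm_cons perm_to_rem.
apply: (IH _ cc _ _ _ h1).
  rewrite -ltnS (leq_trans _ lem) // ltnS proper_card //.
  apply/properP; split; last first.
    by exists l; rewrite !inE ?swap_coordE ?eqxx ?c'l ?eqxx ?andbF // lk lc.
  apply/subsetP=> x; rewrite !inE swap_coordE.
  by have [->|] := eqVneq x l; rewrite ?c'l ?eqxx ?andbF.
by have := eqv_valid h1; rewrite vs /= => /esym/andP[].
Qed.

(** If no private coordinate is used, any cell next to the core one supplies [k]: outside a facet
    containing it, both have base entries. *)
Lemma roomy_ex F s : all (valid F) s -> has (core F) s -> 1 < size s ->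
  exists k, private_used F k s || roomy F k s.
Proof.
move=> vs /hasP[c0 c0s cc] szs.
have [/existsP[k pk]|/existsPn np] := boolP [exists k, private_used F k s].
  by exists k; rewrite pk.
suff /existsP[k rk] : [exists k, [forall j, (j \notin F k) ==>
    (1 < count (fun c => c j == z j) s)]].
  exists k; apply/orP; right; rewrite /roomy rk andbT.
  apply/forallP=> k'; apply/forallP=> j; apply/implyP=> pj.
  have := np k'; rewrite negb_exists => /forallP/(_ j); rewrite pj /= => /hasPn h.
  by apply/allP=> c /h; rewrite negbK.
apply: contraT; rewrite negb_exists => /forallP full.
have hs := perm_to_rem c0s.
have [c [t e]] : exists c t, rem c0 s = c :: t.
  have := perm_size hs; case: (rem c0 s) => [e1|c t _]; first by rewrite e1 in szs.
  by exists c, t.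
have cs : c \in rem c0 s by rewrite e mem_head.
have /validP[k ck] := allP vs _ (mem_rem cs).
have := full k; rewrite negb_forall => /existsP[j]; rewrite negb_imply -leqNgt.
move=> /andP[jk]; move/permP: hs => ->; rewrite e /=.
by move/suppP: (coreP _ _ cc k) => -> //; move/suppP: ck => -> //; rewrite eqxx.
Qed.

(** The choice of [k] depends on entry counts only, so one [k] serves both lists. *)
Lemma roomy_congr F k s t : size s = size t ->
  (forall j w, count (fun c => c j == w) s = count (fun c => c j == w) t) ->
  private_used F k s || roomy F k s = private_used F k t || roomy F k t.
Proof.
move=> st h; congr (_ || _).
  apply: eq_existsb => j; congr (_ && _).
  by rewrite -[LHS]negbK -[RHS]negbK -!all_predC !all_count -st; congr (~~ (_ == _));
     rewrite !(eq_count (a2 := fun c => c j == z j)) // => c; rewrite /= negbK.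
congr (_ && _); last by apply: eq_forallb => j; rewrite h.
apply: eq_forallb => k'; apply: eq_forallb => j.
by rewrite !all_count h st.
Qed.

(** Both lists are moved to contain a core cell and the same cell [e] of one facet; removing [e]
    leaves shorter lists with core cells and equal counts. *)
Lemma eqv_core F s t : all (valid F) s -> all (valid F) t ->
  has (core F) s -> has (core F) t -> size s = size t ->
  (forall j w, count (fun c => c j == w) s = count (fun c => c j == w) t) ->
  eqv F s t.
Proof.
have [m] := ubnP (size s); elim: m s t => // m IH s t lem vs vt cs ct szst cnt.
have [s2|s1] := ltnP 1 (size s); last first.
  case: s t s1 szst cnt {vs vt lem ct} cs => [|c [|? ?]] [|d [|? ?]] //= _ _ cnt _.
  suff -> : c = d by exact: eqvxx.
  by apply/ffunP=> j; move: (cnt j (c j)); rewrite eqxx; case: eqP => // ->.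
have [k rk] := roomy_ex vs cs s2.
have := rk; rewrite (roomy_congr _ _ szst cnt) => rk'.
have [c0 [c [s' [es c0c ck]]]] := eqv_extract vs cs s2 rk.
rewrite szst in s2; have [d0 [d [t' [et d0c dk]]]] := eqv_extract vt ct s2 rk'.
(* Inside [F k], [e] takes a non-base entry wherever [s] has one, so it has the base entry only
   where all cells do, as [eqv_fill] asks. *)
pose e : cell a := finfun (fun j => if j \in F k then
  odflt (z j) [pick w | (w != z j) && has (fun c => c j == w) s] else z j).
have ek : supp e \subset F k.
  by apply/suppP=> j jk; rewrite ffunE (negPf jk).
have eP j : j \in F k -> (has (fun c' => c' j == e j) s) /\
    (e j = z j -> all (fun c' => c' j == z j) s).
  move=> jk; rewrite ffunE jk; case: pickP => [w /andP[wz ws]|h] /=.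
    by split=> // wz'; rewrite wz' eqxx in wz.
  have hz : all (fun c' => c' j == z j) s.
    apply/allP=> c' c's; have := h (c' j); apply: contraFT => c'j.
    by rewrite c'j; apply/hasP; exists c'.
  by split=> //; have /hasP[c1 c1s _] := cs; apply/hasP; exists c1 => //; exact: allP hz _ c1s.
have fill r (r0 r1 : cell a) r' : all (valid F) r -> size s = size r ->
    (forall j w, count (fun c => c j == w) s = count (fun c => c j == w) r) ->
    eqv F r (r0 :: r1 :: r') -> core F r0 -> supp r1 \subset F k ->
  exists (r2 : cell a) r'', core F r2 /\ eqv F r (r2 :: e :: r'').
  move=> vr sr cr er r0c r1k.
  have vr' : all (valid F) r'.
    by have := eqv_valid er; rewrite vr /= => /esym/and3P[].
  have [|j jk ej|r2 [r'' [h1 h2]]] := eqv_fill r0c vr' r1k ek.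
  - by move=> j /eP[h _]; move: h; rewrite !has_count cr (eqv_count _ er).
  - have [_ /(_ ej)] := eP j jk.
    by rewrite !all_count cr sr (eqv_count _ er) (eqv_size er).
  - by exists r2, r''; split=> //; apply: EqvTrans er h2.
have [s2' [s'' [s2c es2]]] := fill _ _ _ _ vs erefl (fun _ _ => erefl) es c0c ck.
have [t2' [t'' [t2c et2]]] := fill _ _ _ _ vt szst cnt et d0c dk.
have perm c2 r : perm_eq [:: c2, e & r] [:: e, c2 & r].
  by rewrite (perm_catCA [:: _] [:: _]).
have es3 := EqvTrans es2 (EqvPerm F (perm s2' s'')).
have et3 := EqvTrans et2 (EqvPerm F (perm t2' t'')).
apply: (EqvTrans es3 (EqvTrans _ (EqvSym et3))); apply: eqv_cons; apply: IH.
- by rewrite -ltnS (leq_trans _ lem) // ltnS (eqv_size es3).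
- by have := eqv_valid es3; rewrite vs /= => /esym/and3P[_ -> ->].
- by have := eqv_valid et3; rewrite vt /= => /esym/and3P[_ -> ->].
- by rewrite /= s2c.
- by rewrite /= t2c.
- by move: szst; rewrite (eqv_size es3) (eqv_size et3) /= => -[->].
- move=> j w; have := cnt j w; rewrite (eqv_count _ es3) (eqv_count _ et3).
  exact: addnI.
Qed.

(** * Separating the facets into blocks *)

Implicit Types (b : 'I_3) (beta : 'I_3 -> 'I_3).

Definition reach F s := exists2 t, eqv F s t & has (core F) t.

Lemma eqv_reach F s t : all (valid F) s -> all (valid F) t ->
  reach F s -> reach F t -> size s = size t ->
  (forall j w, count (fun c => c j == w) s = count (fun c => c j == w) t) ->
  eqv F s t.
Proof.
move=> vs vt [s' ss' cs'] [t' tt' ct'] st cnt.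
apply: (EqvTrans ss' (EqvTrans _ (EqvSym tt'))); apply: eqv_core => //.
- by rewrite -(eqv_valid ss').
- by rewrite -(eqv_valid tt').
- by rewrite -(eqv_size ss') st (eqv_size tt').
- by move=> j w; rewrite -(eqv_count _ ss') cnt (eqv_count _ tt').
Qed.

Definition blk F beta b c := [exists k, (beta k == b) && (supp c \subset F k)].

Lemma blkP F beta b c :
  reflect (exists2 k, beta k = b & supp c \subset F k) (blk F beta b c).
Proof.
apply: (iffP existsP) => [[k /andP[/eqP <- ck]]|[k <- ck]]; first by exists k.
by exists k; rewrite eqxx.
Qed.

(* The negation says that block [beta k] is empty or that some entry in [F k :\: F k'] never
   vanishes on it; in the latter case no cell of [s] in this block is supported in [F k']. *)
Definition linked F beta s k k' :=
  has (blk F beta (beta k)) s &&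
  [forall l, (l \in F k :\: F k') ==>
     has (fun c => blk F beta (beta k) c && (c l == z l)) s].

Definition good F beta s :=
  [forall k, forall k', (beta k != beta k') ==> ~~ linked F beta s k k'].

(* The variables of the cells that are not alive are sent to [0] by the monomial map of [s]. *)
Definition alive F beta s c := [forall b, blk F beta b c ==>
  has (blk F beta b) s &&
  [forall l, (c l == z l) ==> has (fun c' => blk F beta b c' && (c' l == z l)) s]].

(** [None] marks the cells in no facet, which take part in no move. When [beta] is good, the label
    of an alive cell does not depend on the facet picked. *)
Definition label F beta c := omap beta [pick k | supp c \subset F k].

Lemma goodP F beta s k k' : good F beta s -> linked F beta s k k' -> beta k = beta k'.
Proof.
move=> /forallP/(_ k)/forallP/(_ k')/implyP g kk'; apply: contraTeq kk'; exact: g.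
Qed.

Lemma aliveP F beta s c k : alive F beta s c -> supp c \subset F k ->
  has (blk F beta (beta k)) s /\
  forall l, c l = z l -> has (fun c' => blk F beta (beta k) c' && (c' l == z l)) s.
Proof.
move=> /forallP/(_ (beta k)) al ck; have bc : blk F beta (beta k) c by apply/blkP; exists k.
by move: al; rewrite bc /= => /andP[-> /forallP h]; split=> // l cl; move: (h l); rewrite cl eqxx.
Qed.

Lemma alive_self F beta s : all (alive F beta s) s.
Proof.
apply/allP=> c cs; apply/forallP=> b; apply/implyP=> bc; apply/andP; split.
  by apply/hasP; exists c.
by apply/forallP=> l; apply/implyP=> cl; apply/hasP; exists c => //; rewrite bc.
Qed.

(** The cell has base entries on [F k :\: F k']; being alive, it has them only where its block in
    [s] does, and this links [k] to [k']. *)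
Lemma alive_disj F beta s c k k' : good F beta s -> alive F beta s c ->
  supp c \subset F k -> supp c \subset F k' -> beta k = beta k'.
Proof.
move=> g al ck /suppP ck'; have [hs hz] := aliveP al ck.
apply: (goodP g); rewrite /linked hs; apply/forallP=> l; apply/implyP.
by rewrite inE => /andP[lk' _]; apply: hz; apply: ck'.
Qed.

Lemma label_alive F beta s c k : good F beta s -> alive F beta s c ->
  supp c \subset F k -> label F beta c = Some (beta k).
Proof.
move=> g al ck; rewrite /label; case: pickP => [k' ck'|/(_ k)]; last by rewrite ck.
by rewrite /= (alive_disj g al ck' ck).
Qed.

Lemma label_blk F beta b c : label F beta c = Some b -> blk F beta b c.
Proof. by rewrite /label; case: pickP => //= k ck [<-]; apply/blkP; exists k. Qed.

(** Every base entry of the new cell comes from [u] or [v], hence occurs in the block of [k] in [s].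
    If the new cell also lies in [F k'], this links [k] to [k']. *)
Lemma alive_swap F beta s k l u v : good F beta s ->
  supp u \subset F k -> supp v \subset F k ->
  alive F beta s u -> alive F beta s v -> alive F beta s (swap_coord l u v).
Proof.
move=> g uk vk au av; have [hs hu] := aliveP au uk; have [_ hv] := aliveP av vk.
have hz l' : swap_coord l u v l' = z l' ->
    has (fun c' => blk F beta (beta k) c' && (c' l' == z l')) s.
  by rewrite swap_coordE; case: ifP => _ ?; [apply: hu|apply: hv].
apply/forallP=> b; apply/implyP=> /blkP[k' <- /suppP wk'].
have <- : beta k = beta k'.
  apply: (goodP g); rewrite /linked hs; apply/forallP=> l'; apply/implyP.
  by rewrite inE => /andP[lk' _]; apply/hz/wk'.
by rewrite hs; apply/forallP=> l'; apply/implyP=> /eqP; apply: hz.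
Qed.

Lemma eqv_alive F beta s t t' : good F beta s -> eqv F t t' ->
  all (alive F beta s) t = all (alive F beta s) t'.
Proof.
move=> g; apply: eqv_all => k l u v uk vk; apply/andP/andP => -[hu hv].
  by split; apply: (alive_swap (k := k)).
split; [rewrite -(swap_coordC l u v)|rewrite -(swap_coordC l v u)];
  by apply: (alive_swap (k := k)) => //; apply: supp_swap2.
Qed.

(** Base entries of alive cells already occur in the same block of [s], so a link in [t] is one in
    [s]. *)
Lemma good_alive F beta s t : good F beta s -> all (alive F beta s) t -> good F beta t.
Proof.
move=> g al; apply/forallP=> k; apply/forallP=> k'; apply/implyP; apply: contraNN.
case/andP=> /hasP[c ct /blkP[k1 e ck1]] /forallP lk.
apply/eqP/(goodP g); rewrite /linked -e; have [-> _] := aliveP (allP al _ ct) ck1.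
apply/forallP=> l; apply/implyP=> /(implyP (lk l)) /hasP[c' c't].
case/andP=> /blkP[k2 e2 c'k2] /eqP c'l; rewrite e -e2.
by have [_] := aliveP (allP al _ c't) c'k2; apply.
Qed.

Lemma eqv_good F beta s t : eqv F s t -> good F beta s -> good F beta t.
Proof. by move=> st g; apply: (good_alive g); rewrite -(eqv_alive g st) alive_self. Qed.

(** Within the single facet [F k] every cell is core, so one cell can gather base entries on all of
    [F k :\: F k']. *)
Lemma link F s k k' : linked F id s k k' ->
  exists c t, [/\ eqv (fun=> F k) s (c :: t), supp c \subset F k & supp c \subset F k'].
Proof.
have bE c : blk F id k c = (supp c \subset F k).
  by apply/blkP/idP => [[? <-]//|ck]; exists k.
rewrite /linked (eq_has bE) has_filter => /andP[].
case e : [seq c <- s | supp c \subset F k] => [//|c r] _ /forallP lk.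
have ins x : x \in c :: r -> supp x \subset F k.
  by rewrite -e mem_filter => /andP[].
have ck := ins _ (mem_head c r).
have [||l|t ht] := @eqv_gather (fun=> F k) (F k :\: F k') c r.
- by apply/coreP.
- by apply/allP=> x xr; apply/validP; exists ord0; apply: ins; rewrite inE xr orbT.
- move/(implyP (lk l)) => /hasP[x xs]; rewrite bE => /andP[xk xl].
  by apply/hasP; exists x => //; rewrite -e mem_filter xk.
set c1 := finfun _ in ht; pose s' := [seq c <- s | ~~ (supp c \subset F k)].
have c1E l : c1 l = if l \in F k :\: F k' then z l else c l by rewrite ffunE.
exists c1, (t ++ s'); split.
- apply: EqvTrans (eqv_catr s' ht); rewrite -e.
  by apply: EqvPerm; rewrite perm_sym; apply: permEl; exact: perm_filterC.
- by apply/suppP=> l lk1; rewrite c1E inE (negPf lk1) andbF; exact: (suppP _ _ ck).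
- apply/suppP=> l lk1; rewrite c1E inE lk1 /=; case: ifP => // /negbT.
  exact: (suppP _ _ ck).
Qed.

(** * Reaching a core cell in every block *)

Definition part F beta b s := [seq c <- s | label F beta c == Some b].

(** The facets of the block of [k0], with [F k0] repeated to keep three indices. *)
Definition block F beta k0 k := if beta k == beta k0 then F k else F k0.

Definition isolate (m k : 'I_3) : 'I_3 := if k == m then ord_max else ord0.

Lemma block_eqv F beta k0 s t : eqv (block F beta k0) s t -> eqv F s t.
Proof.
by apply: eqv_sub => k; rewrite /block; case: ifP => _; [exists k|exists k0].
Qed.

Lemma part_valid F beta k0 s : all (valid (block F beta k0)) (part F beta (beta k0) s).
Proof.
apply/allP=> c; rewrite mem_filter => /andP[/eqP /label_blk /blkP[k e ck] _].
by apply/validP; exists k; rewrite /block e eqxx.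
Qed.

Lemma has_reach F s : has (core F) s -> reach F s.
Proof. by exists s => //; exact: eqvxx. Qed.

Lemma not_goodP F beta s : ~~ good F beta s ->
  exists k k', beta k != beta k' /\ linked F beta s k k'.
Proof.
rewrite negb_forall => /existsP[k]; rewrite negb_forall => /existsP[k'].
by rewrite negb_imply negbK => /andP[? ?]; exists k, k'.
Qed.

Lemma reach_single F s k0 : part F id k0 s != [::] ->
  reach (block F id k0) (part F id k0 s).
Proof.
move=> h; apply: has_reach; case e : (part F id k0 s) h => [//|c r] _ /=.
have : c \in part F id k0 s by rewrite e mem_head.
rewrite mem_filter => /andP[/eqP /label_blk /blkP[k -> ck] _].
by rewrite (_ : core _ c) //; apply/coreP=> k'; rewrite /block; case: eqP => [->|].
Qed.

Lemma link_good F beta s k k' : good F beta s -> linked F id s k k' -> beta k = beta k'.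
Proof.
move=> g /andP[/hasP[c cs /blkP[_ -> ck]] /forallP h]; apply: (goodP g).
apply/andP; split; first by apply/hasP; exists c => //; apply/blkP; exists k.
apply/forallP=> l; apply/implyP=> /(implyP (h l)) /hasP[d ds /andP[/blkP[_ -> dk] dl]].
by apply/hasP; exists d => //; rewrite dl andbT; apply/blkP; exists k.
Qed.

Lemma link_part F beta s k k' : good F beta s -> linked F id s k k' ->
  linked F id (part F beta (beta k) s) k k'.
Proof.
move=> g /andP[/hasP[c cs ck] /forallP h].
have ins x : x \in s -> blk F id k x -> x \in part F beta (beta k) s.
  move=> xs /blkP[_ -> xk]; rewrite mem_filter xs andbT.
  by rewrite (label_alive g _ xk) //; exact: (allP (alive_self F beta s)).
apply/andP; split; first by apply/hasP; exists c => //; apply: ins.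
apply/forallP=> l; apply/implyP=> /(implyP (h l)) /hasP[d ds /andP[dk dl]].
by apply/hasP; exists d; [apply: ins|rewrite dk].
Qed.

Lemma isolate_pair m k1 k2 k : k1 != k2 -> isolate m k1 = isolate m k2 ->
  isolate m k = isolate m k1 -> k = k1 \/ k = k2.
Proof.
rewrite /isolate => k12; case: (eqVneq k1 m) k12 => [->|k1m] k12.
  by case: (eqVneq k2 m) k12 => [->|] //; rewrite eqxx.
case: (eqVneq k2 m) => // k2m _; case: (eqVneq k m) => // km _.
by case/or3P: (@ord3_cases k1 k2 m k k12 k1m k2m) => /eqP; auto; move/eqP; rewrite (negPf km).
Qed.

(** The failure of [good F id s] links two facets, which by [link_good] form the two-element block;
    the linking cell is core there. In a block with one facet every cell is core. *)
Lemma reach_isolate F m s k0 : good F (isolate m) s -> ~~ good F id s ->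
  part F (isolate m) (isolate m k0) s != [::] ->
  reach (block F (isolate m) k0) (part F (isolate m) (isolate m k0) s).
Proof.
move=> g /not_goodP[k [k' [kk' lk]]] ne.
have e := link_good g lk.
have [ek0|ek0] := eqVneq (isolate m k0) (isolate m k).
  rewrite ek0; have [c [t [h ck ck']]] := link (link_part g lk).
  exists (c :: t); first by apply: eqv_sub h => _; exists k; rewrite /block ek0 eqxx.
  rewrite /= (_ : core _ c) //; apply/coreP=> k1; rewrite /block.
  have pr k2 : isolate m k2 = isolate m k0 -> supp c \subset F k2.
    by rewrite ek0 => /(isolate_pair kk' e) [->|->].
  by case: eqP => [/pr //|_]; exact: pr.
have single k1 : isolate m k1 = isolate m k0 -> k1 = k0.
  move=> e1; apply/eqP; move: ek0 e e1 kk'; rewrite /isolate.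
  case: (eqVneq k0 m) => [->|k0m]; first by case: (eqVneq k1 m).
  case: (eqVneq k m) => [->|km] //.
  by case: (eqVneq k' m).
apply: has_reach; case es : (part _ _ _ s) ne => [//|c r] _ /=.
have : c \in part F (isolate m) (isolate m k0) s by rewrite es mem_head.
rewrite mem_filter => /andP[/eqP /label_blk /blkP[k1 /single -> ck] _].
by rewrite (_ : core _ c) //; apply/coreP=> k2; rewrite /block; case: eqP => [/single ->|].
Qed.

Lemma has_blk_part F beta b' s (p : pred (cell a)) (const := fun=> ord0 : 'I_3) :
  has (fun c => blk F beta b' c && p c) (part F const ord0 s) =
  has (fun c => blk F beta b' c && p c) s.
Proof.
rewrite has_filter /part -filter_predI -has_filter; apply: eq_has => c /=.
case: (blkP F beta b' c) => [[k _ ck]|]; rewrite ?andbF //=.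
by rewrite /label; case: pickP => [k' _|/(_ k)]; rewrite ?andbT ?ck.
Qed.

Lemma good_part F beta s : good F beta (part F (fun=> ord0) ord0 s) = good F beta s.
Proof.
apply: eq_forallb => k; apply: eq_forallb => k'; congr (_ ==> ~~ (_ && _)).
  have e : blk F beta (beta k) =1 (fun c => blk F beta (beta k) c && predT c).
    by move=> c; rewrite andbT.
  by rewrite !(eq_has e) has_blk_part.
by apply: eq_forallb => l; rewrite has_blk_part.
Qed.

Lemma isolate_neq m k k' : isolate m k != isolate m k' ->
  (k = m /\ k' != m) \/ (k != m /\ k' = m).
Proof.
rewrite /isolate; case: (eqVneq k m) => h; case: (eqVneq k' m) => h';
  by rewrite ?eqxx // => _; auto.
Qed.

(** Two linked facets [x] and [y] give a cell [c] in both. As isolating the third facet [m] fails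
    too, [c] can obtain base entries outside [F m], which makes it core. *)
Lemma reach_all F s : all (valid F) s ->
  ~~ good F id s -> (forall m, ~~ good F (isolate m) s) -> reach F s.
Proof.
move=> vs /not_goodP[x [y [xy /link[c [t [h cx cy]]]]]] ng.
have {}h : eqv F s (c :: t) by apply: eqv_sub h => _; exists x.
have vt : all (valid F) (c :: t) by rewrite -(eqv_valid h).
have [/hasP[d dct dc]|nc] := boolP (has (core F) (c :: t)).
  by exists (c :: t) => //; apply/hasP; exists d.
have [m xm ym] : exists2 m : 'I_3, x != m & y != m.
  have /subsetPn[m _] : ~~ (setT \subset [set x; y]).
    by apply/negP=> /subset_leq_card; rewrite cardsT card_ord cards2; case: (x != y).
  by rewrite !inE negb_or ![m == _]eq_sym => /andP[? ?]; exists m.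
have core_m d : supp d \subset F x -> supp d \subset F y -> supp d \subset F m -> core F d.
  move=> dx dy dm; apply/coreP=> k.
  by case/or3P: (@ord3_cases x y m k xy xm ym) => /eqP->.
have : ~~ good F (isolate m) (c :: t).
  by apply: contra (ng m) => /(eqv_good (EqvSym h)).
have zeroed X P (d : cell a) : supp d \subset X ->
    supp (finfun (fun l => if l \in P then z l else d l) : cell a) \subset X.
  by move=> /suppP dX; apply/suppP=> l lX; rewrite ffunE; case: ifP => // _; apply: dX.
have done_ P (d : cell a) t' : supp d \subset F m :|: P -> supp d \subset F x ->
    supp d \subset F y ->
    eqv F s ((finfun (fun l => if l \in P then z l else d l) : cell a) :: t') ->
    reach F s.
  move=> /suppP dm dx dy h1; exists (finfun (fun l => if l \in P then z l else d l) :: t') => //=.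
  apply/orP; left; apply: core_m; [exact: zeroed|exact: zeroed|].
  apply/suppP=> l lm; rewrite ffunE; case: ifP => // /negbT lP.
  by apply: dm; rewrite inE negb_or lm.
have inxy k : k != m -> supp c \subset F k.
  by move=> km; case/or3P: (@ord3_cases x y m k xy xm ym) km => /eqP-> // /eqP.
case/not_goodP=> k [k' [/isolate_neq[[-> k'm]|[km ->]] /andP[]]]; last first.
  (* Here the block of [x] and [y] is linked to [m]. Replacing [F m] by [F k] makes [c] core for
     [G], so it can gather base entries on [F k :\: F m]. *)
  move=> _ /forallP hl; pose G (i : 'I_3) := if i == m then F k else F i.
  have [||l|t' ht'] := @eqv_gather G (F k :\: F m) c [seq d <- t | valid G d].
  - by apply/coreP=> i; rewrite /G; case: eqVneq => [_|/inxy//]; exact: inxy.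
  - exact: filter_all.
  - move/(implyP (hl l)) => /hasP[d dct /andP[/blkP[k2 e2 dk2] dl]].
    apply/hasP; exists d => //; move: dct; rewrite !inE => /orP[->//|dt].
    rewrite mem_filter dt andbT; apply/orP; right; apply/validP; exists k2.
    rewrite /G; case: eqVneq e2 => [->|] //.
    by rewrite /isolate eqxx (negPf km).
  apply: (done_ (F k :\: F m) c (t' ++ [seq d <- t | ~~ valid G d])) => //.
    by apply: subset_trans (inxy _ km) _; apply/subsetP=> l lk; rewrite !inE lk andbT orbN.
  apply: EqvTrans h _; apply: EqvTrans (EqvPerm _ _) _; last first.
    apply: (eqv_catr _ (t := _ :: t')); apply: eqv_sub ht' => i.
    by rewrite /G; case: ifP => _; [exists k|exists i].
  by rewrite perm_cons perm_sym; apply: permEl; exact: perm_filterC.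
(* Here [m] is linked to [k'], one of [x] and [y]. The link yields a cell [d] in [F m] and [F k'],
   which gives [c] base entries outside [F m] by exchanges within [F k']. *)
move=> hm /forallP hl.
have bm d : blk F (isolate m) (isolate m m) d = (supp d \subset F m).
  apply/blkP/idP=> [[k2]|]; last by exists m.
  by rewrite /isolate eqxx; case: eqP => // ->.
have ncm : supp c \subset F m = false.
  apply: contraNF nc => cm; by rewrite /= core_m.
have : linked F id t m k'.
  have bi d : blk F id m d = (supp d \subset F m).
    by apply/blkP/idP=> [[k2 ->]|] //; exists m.
  apply/andP; split; first by move: hm; rewrite /= bm ncm (eq_has bm) (eq_has bi).
  apply/forallP=> l; apply/implyP=> /(implyP (hl l)); rewrite /= bm ncm /=.
  by rewrite (eq_has (a2 := fun d => blk F id m d && (d l == z l))) // => d; rewrite bm bi.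
case/link=> d [t' [ht' dm dk']].
have [||l|r hr] := @eqv_gather (fun=> F k') (~: F m) c [:: d].
- by apply/coreP=> _; exact: inxy.
- by rewrite /= andbT; apply/validP; exists ord0.
- by rewrite inE => lm; rewrite /= (suppP _ _ dm l lm) eqxx orbT.
apply: (done_ (~: F m) c (r ++ t')) => //; first by rewrite setUCr subsetT.
apply: EqvTrans h (EqvTrans (eqv_cons c _) _); first by apply: eqv_sub ht' => _; exists m.
by apply: (eqv_catr t' (s := [:: c; d]) (t := _ :: r)); apply: eqv_sub hr => _; exists k'.
Qed.

(** * Entry counts by block separate the classes *)

Definition coord := {j : 'I_n & 'I_(a j)}.

(** These index the target variables: a cell in no facet is recorded as itself, any other by its
    block and by each entry tagged with that block. *)
Definition feature F beta c (x : cell a + 'I_3 * option coord) : bool :=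
  match x with
  | inl d => (label F beta c == None) && (c == d)
  | inr (b, None) => label F beta c == Some b
  | inr (b, Some y) => (label F beta c == Some b) && (c (tag y) == tagged y)
  end.

Lemma feature_swap F beta s k l u v x : good F beta s ->
  supp u \subset F k -> supp v \subset F k ->
  alive F beta s u -> alive F beta s v ->
  feature F beta u x + feature F beta v x =
  feature F beta (swap_coord l u v) x + feature F beta (swap_coord l v u) x.
Proof.
move=> g uk vk au av; have sw := supp_swap2 l.
have lab w : supp w \subset F k -> alive F beta s w -> label F beta w = Some (beta k).
  by move=> wk aw; exact: label_alive g aw wk.
case: x => [d|[b [[j w]|]]] /=; rewrite !lab //; do ?[exact: sw];
  do ?[by apply: (alive_swap (k := k))].
case: eqP => //= _; rewrite !swap_coordE.
by case: (j == l) => //; rewrite addnC.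
Qed.

Lemma part_perm F beta s : perm_eq s
  ([seq c <- s | label F beta c == None] ++ flatten [seq part F beta b s | b <- enum 'I_3]).
Proof.
apply/permP=> p; rewrite count_cat count_flatten -map_comp sumnE big_map big_enum /=.
under eq_bigr => b _ do rewrite count_filter.
rewrite count_filter; elim: s => [|c s IH] /=; first by rewrite big1.
rewrite {}IH big_split addnACA; congr (_ + _); case: (label F beta c) => [b|].
  rewrite andbF (bigD1 b) //= eqxx andbT big1 ?addn0 // => k kb.
  by rewrite eq_sym (inj_eq (@Some_inj _)) (negPf kb) andbF.
by rewrite eqxx andbT big1 ?addn0 // => k _; rewrite andbF.
Qed.

(** Cells in no facet are counted individually; in each nonempty block [eqv_reach] applies to the
    facets of that block alone. *)
Lemma eqv_part F beta s t :
  (forall x, count (fun c => feature F beta c x) s = count (fun c => feature F beta c x) t) ->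
  (forall k, part F beta (beta k) s != [::] ->
     reach (block F beta k) (part F beta (beta k) s)) ->
  (forall k, part F beta (beta k) t != [::] ->
     reach (block F beta k) (part F beta (beta k) t)) ->
  eqv F s t.
Proof.
move=> cnt rs rt.
have sz b : size (part F beta b s) = size (part F beta b t).
  by have := cnt (inr (b, None)); rewrite !size_filter.
have free : perm_eq [seq c <- s | label F beta c == None] [seq c <- t | label F beta c == None].
  apply/allP=> d _; have := cnt (inl d); rewrite /= !count_filter => e; apply/eqP.
  by etransitivity; [|etransitivity; [exact: e|]]; apply: eq_count => c /=; rewrite andbC.
apply: EqvTrans (EqvPerm _ (part_perm F beta s)) _.
apply: EqvSym; apply: EqvTrans (EqvPerm _ (part_perm F beta t)) _; apply: EqvSym.
apply: eqv_cat; first exact: EqvPerm.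
elim: (enum 'I_3) => [|b bs IH] /=; first exact: eqvxx.
apply: eqv_cat => //.
have [s0|s0] := eqVneq (part F beta b s) [::].
  by have := sz b; rewrite s0 => /esym/size0nil ->; exact: eqvxx.
have t0 : part F beta b t != [::] by rewrite -size_eq0 -sz size_eq0.
have [k ek] : exists k, beta k = b.
  case e : (part F beta b s) s0 => [//|c r] _.
  have : c \in part F beta b s by rewrite e mem_head.
  by rewrite mem_filter => /andP[/eqP/label_blk/blkP[k]]; exists k.
rewrite -ek in s0 t0 *.
apply: (block_eqv (beta := beta) (k0 := k)); apply: eqv_reach.
- exact: part_valid.
- exact: part_valid.
- exact: rs.
- exact: rt.
- exact: sz.
move=> j w; have := cnt (inr (beta k, Some (Tagged (fun j => 'I_(a j)) w))).
rewrite /= !count_filter => e.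
by etransitivity; [|etransitivity; [exact: e|]]; apply: eq_count => c /=; rewrite andbC.
Qed.

(** It measures how coarse the finest good partition is. *)
Definition rank F s :=
  if good F id s then 0 else if [exists m, good F (isolate m) s] then 1 else 2.

Definition blocks F s : 'I_3 -> 'I_3 :=
  if good F id s then id
  else if [pick m | good F (isolate m) s] is Some m then isolate m else fun=> ord0.

Lemma good_blocks F s : good F (blocks F s) s.
Proof.
rewrite /blocks; case: ifP => // _; case: pickP => // _.
by apply/forallP=> k; apply/forallP=> k'; rewrite eqxx.
Qed.

Lemma reach_const F s : ~~ good F id s -> (forall m, ~~ good F (isolate m) s) ->
  forall k, reach (block F (fun=> ord0) k) (part F (fun=> ord0) ord0 s).
Proof.
move=> ng1 ng2 k; set q := part _ _ _ _.
have [t qt ct] : reach F q.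
  apply: reach_all => [||m]; rewrite ?good_part //.
  apply/allP=> c; rewrite mem_filter => /andP[/eqP/label_blk/blkP[k' _ ck'] _].
  by apply/validP; exists k'.
exists t; first by apply: eqv_sub qt => k'; exists k'; rewrite /block eqxx.
apply: sub_has ct => c /coreP cc; apply/coreP=> k'; rewrite /block eqxx; exact: cc.
Qed.

(** Goodness of the partition of [s] passes to [t] by aliveness, and the rank comparison excludes a
    good partition of lower rank for [t]. So every nonempty block of both lists reaches a core
    cell. *)
Lemma eqv_blocks F s t : rank F s <= rank F t ->
  all (alive F (blocks F s) s) t ->
  (forall x, count (fun c => feature F (blocks F s) c x) s =
             count (fun c => feature F (blocks F s) c x) t) ->
  eqv F s t.
Proof.
move=> rst /(good_alive (good_blocks F s)); move: rst.
rewrite /rank /blocks; case: (boolP (good F id s)) => gs.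
  by move=> _ _ cnt; apply: eqv_part cnt _ _ => k; apply: reach_single.
case: ifP => [/existsP[m gm]|] rt.
  case: pickP => [m' gm'|/(_ m)]; last by rewrite gm.
  case: (boolP (good F id t)) rt => // gt _ gt' cnt.
  by apply: eqv_part cnt _ _ => k; apply: reach_isolate.
case: pickP => [m gm|nm]; first by move/existsP: rt; case; exists m.
case: ifP => // /negbT gt; case: ifP => // /negbT; rewrite negb_exists => /forallP nmt _ _ cnt.
by apply: eqv_part cnt _ _ => k _; apply: reach_const => // m; rewrite nm.
Qed.

End Cells.

Import GRing.Theory.
Local Open Scope ring_scope.

(** * Radicality of the ideal of moves *)

Section Ideals.

Variables (R : comNzRingType) (S : R -> Prop).
Implicit Types (p q r : R).

Lemma ideal_gen0 : ideal_gen S 0.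
Proof. by exists [::]; rewrite big_nil. Qed.

Lemma ideal_genD p q : ideal_gen S p -> ideal_gen S q -> ideal_gen S (p + q).
Proof.
move=> [s [hs ->]] [t [ht ->]]; exists (s ++ t); rewrite big_cat; split=> // x.
by rewrite mem_cat => /orP[/hs|/ht].
Qed.

Lemma ideal_genMl r p : ideal_gen S p -> ideal_gen S (r * p).
Proof.
move=> [s [hs ->]]; exists [seq (r * x.1, x.2) | x <- s]; split.
  by move=> x /mapP[y ys ->]; exact: (hs y).
by rewrite big_map mulr_sumr; apply: eq_bigr => x _; rewrite mulrA.
Qed.

Lemma ideal_genN p : ideal_gen S p -> ideal_gen S (- p).
Proof. by rewrite -mulN1r; exact: ideal_genMl. Qed.

Lemma ideal_genB p q : ideal_gen S p -> ideal_gen S q -> ideal_gen S (p - q).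
Proof. by move=> hp hq; apply/ideal_genD/ideal_genN. Qed.

Lemma ideal_gen_mem p : S p -> ideal_gen S p.
Proof. by exists [:: (1, p)]; rewrite big_seq1 mul1r; split=> // x /[!inE]/eqP->. Qed.

Lemma ideal_gen_sum (I : Type) (s : seq I) (P : pred I) (f : I -> R) :
  (forall i, P i -> ideal_gen S (f i)) -> ideal_gen S (\sum_(i <- s | P i) f i).
Proof. by move=> h; elim/big_rec: _ => [|i p /h]; [exact: ideal_gen0|exact: ideal_genD]. Qed.

Lemma ideal_gen_congrX p q k : ideal_gen S (p - q) -> ideal_gen S (p ^+ k) ->
  ideal_gen S (q ^+ k).
Proof.
move=> pq hp; rewrite -(subKr (p ^+ k) (q ^+ k)) subrXX; apply: ideal_genB => //.
by rewrite mulrC; apply: ideal_genMl.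
Qed.

End Ideals.

Lemma ideal_gen_morph (R R' : comNzRingType) (f : {rmorphism R -> R'}) S S' p :
  (forall q, S q -> ideal_gen S' (f q)) -> ideal_gen S p -> ideal_gen S' (f p).
Proof.
move=> h [s [hs ->]]; rewrite rmorph_sum big_seq; apply: ideal_gen_sum => x xs.
by rewrite rmorphM; apply/ideal_genMl/h/hs.
Qed.

Lemma ideal_gen_ker (R R' : comNzRingType) (f : {rmorphism R -> R'}) S p :
  (forall q, S q -> f q = 0) -> ideal_gen S p -> f p = 0.
Proof.
move=> h [s [hs ->]]; rewrite rmorph_sum big_seq big1 // => x xs.
by rewrite rmorphM (h _ (hs _ xs)) mulr0.
Qed.

(* Equivalent monomials may be merged modulo the ideal, so assume that the monomials of [f]
   are separated. The morphism attached to one of least rank then maps [f] to a nonzero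
   polynomial, which is not nilpotent. *)
Lemma radical_of_separating (K : fieldType) (N N' : nat) (S : {mpoly K[N]} -> Prop)
    (rk : 'X_{1..N} -> nat)
    (phi : 'X_{1..N} -> {lrmorphism {mpoly K[N]} -> {mpoly K[N']}})
    (wt : 'X_{1..N} -> 'X_{1..N} -> option 'X_{1..N'}) :
  (forall m m', phi m 'X_[m'] = if wt m m' is Some w then 'X_[w] else 0) ->
  (forall m p, S p -> phi m p = 0) ->
  (forall m, wt m m) ->
  (forall m m', (rk m <= rk m')%N -> wt m m' = wt m m -> ideal_gen S ('X_[m] - 'X_[m'])) ->
  radical_ideal S.
Proof.
move=> phiX phiS wtmm sep f k.
have phiZ m c m' : phi m (c *: 'X_[m']) = c *: phi m 'X_[m'] by exact: linearZZ.
have [b] := ubnP (size (msupp f)); elim: b f => // b IH f lef fk.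
have [->|f0] := eqVneq f 0; first exact: ideal_gen0.
have [m mf minm] : exists2 m, m \in msupp f &
    forall m', m' \in msupp f -> (rk m <= rk m')%N.
  have : exists i, has (fun m => rk m == i) (msupp f).
    case e : (msupp f) => [|m s]; first by move: f0; rewrite -msupp_eq0 e.
    by exists (rk m); rewrite /= eqxx.
  case/ex_minnP=> i /hasP[m mf /eqP <-] h; exists m => // m' m'f.
  by apply: h; apply/hasP; exists m'.
have [/hasP[m' m'f /andP[m'm /eqP e]]|/hasPn ne] :=
    boolP (has (fun m' => (m' != m) && (wt m m' == wt m m)) (msupp f)).
  have hI := sep m m' (minm _ m'f) e.
  (* Adding [d] trades the monomial [m'] for [m], which shrinks the support and changes [f] only by
     an element of the ideal. *)
  pose d := f@_m' *: ('X_[m] - 'X_[m']).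
  have hd : ideal_gen S d by rewrite /d -mul_mpolyC; apply: ideal_genMl.
  suff h : ideal_gen S (f + d) by rewrite -(addrK d f); apply: ideal_genB.
  apply: IH; last first.
    by apply: ideal_gen_congrX fk; rewrite opprD addNKr; apply: ideal_genN.
  rewrite -ltnS (leq_trans _ lef) // ltnS.
  have f_pos : (0 < size (msupp f))%N by case: (msupp f) m'f.
  rewrite -(prednK f_pos) ltnS -(size_rem m'f); apply: uniq_leq_size => // q.
  rewrite (rem_filter _ (msupp_uniq f)) mem_filter /= !mcoeff_msupp.
  rewrite mcoeffD mcoeffZ mcoeffB !mcoeffX.
  have [->|qm'] /= := eqVneq q m';
    first by rewrite [m == _]eq_sym (negPf m'm) sub0r mulrN1 subrr eqxx.
  have [->|qm] := eqVneq q m; first by rewrite -mcoeff_msupp mf.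
  by rewrite /= subrr mulr0 addr0.
(* Only [m] contributes to the coefficient of [w] in the image of [f]. *)
have fm : phi m f != 0.
  have := wtmm m; case ew : (wt m m) => [w|] // _.
  apply: contraTneq (mf) => /(congr1 (mcoeff w)); rewrite mcoeff0 => fw.
  rewrite mcoeff_msupp negbK -fw [in X in _ == X](mpolyE f) !raddf_sum /=.
  rewrite (big_rem m) //= phiZ phiX ew mcoeffZ mcoeffX eqxx mulr1.
  rewrite big_seq big1 ?addr0 // => q; rewrite (rem_filter _ (msupp_uniq f)) mem_filter.
  move=> /andP[/= qm qf]; rewrite phiZ phiX mcoeffZ.
  have := ne q qf; rewrite qm /= ew; case: (wt m q) => [w'|]; last by rewrite mcoeff0 mulr0.
  by move=> h; rewrite mcoeffX (_ : w' == w = false) ?mulr0 //; apply: contraNF h => /eqP->.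
have : phi m (f ^+ k) = 0 by apply: ideal_gen_ker fk => q; exact: phiS.
by move/eqP; rewrite rmorphXn expf_eq0 (negPf fm) andbF.
Qed.

(** * The monomial maps attached to lists of cells *)

Section Moves.

Variables (K : fieldType) (n : nat) (a : 'I_n -> nat) (z : cell a).
Variable F : 'I_3 -> {set 'I_n}.
Implicit Types (c u v : cell a) (s t : seq (cell a)).

Definition move (p : polyR K a) := exists k l u v,
  [/\ supp z u \subset F k, supp z v \subset F k, l \in F k &
   p = xvar K u * xvar K v - xvar K (swap_coord l u v) * xvar K (swap_coord l v u)].

Definition monomial s : polyR K a := \prod_(c <- s) xvar K c.

Lemma eqv_ideal s t : eqv z F s t -> ideal_gen move (monomial s - monomial t).
Proof.
elim=> [{}s {}t st|k l u v {}s hu hv hl|{}s {}t _ h|s1 s2 s3 _ h1 _ h2].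
- by rewrite /monomial (perm_big _ st) subrr; exact: ideal_gen0.
- rewrite /monomial !big_cons !mulrA -mulrBl mulrC.
  by apply/ideal_genMl/ideal_gen_mem; exists k, l, u, v.
- by rewrite -opprB; exact: ideal_genN.
- by rewrite -(subrKA (monomial s2)); exact: ideal_genD.
Qed.

Definition cells (m : 'X_{1..#|cell a|}) : seq (cell a) :=
  flatten [seq nseq (m (enum_rank c)) c | c <- enum (cell a)].

Lemma monomial_cells m : 'X_[m] = monomial (cells m).
Proof.
rewrite /monomial big_flatten big_map big_enum mpolyXE_id /=.
rewrite (reindex enum_rank); last by apply: onW_bij; exact: enum_rank_bij.
by apply: eq_bigr => c _; rewrite big_nseq -Monoid.iteropE.
Qed.

Notation V := (cell a + 'I_3 * option (coord a))%type.

Definition weight beta c : 'X_{1..#|{: V}|} :=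
  [multinom nat_of_bool (feature z F beta c (enum_val i)) | i < #|{: V}|].

Definition grading beta s : polyR K a -> {mpoly K[#|{: V}|]} :=
  comp_mpoly [tuple if alive z F beta s (enum_val i) then 'X_[weight beta (enum_val i)] else 0
             | i < #|cell a|].

HB.instance Definition _ beta s := GRing.LRMorphism.on (grading beta s).

Lemma grading_monomial beta s t : grading beta s (monomial t) =
  if all (alive z F beta s) t then 'X_[\sum_(c <- t) weight beta c] else 0.
Proof.
rewrite rmorph_prod /=; elim: t => [|c t IH]; first by rewrite !big_nil mpolyX0.
rewrite !big_cons {}IH /grading /xvar comp_mpolyXU -tnth_nth tnth_mktuple enum_rankK /=.
by case: ifP; rewrite ?mul0r //; case: ifP; rewrite ?mulr0 // mpolyXD.
Qed.

Lemma weight_sum beta s x :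
  (\sum_(c <- s) weight beta c)%MM (enum_rank x) = count (fun c => feature z F beta c x) s.
Proof.
by rewrite mnm_sumE; elim: s => [|c s IH]; rewrite ?big_nil ?big_cons //= IH mnmE enum_rankK.
Qed.

(** By [eqv_alive] the two monomials of a move are both killed or both kept; if kept, [feature_swap]
    equates their exponents. *)
Lemma grading_move beta s p : good z F beta s -> move p -> grading beta s p = 0.
Proof.
move=> g [k [l [u [v [uk vk lk ->]]]]].
have mono2 c d : xvar K c * xvar K d = monomial [:: c; d].
  by rewrite /monomial big_cons big_seq1.
have h := EqvMove [::] uk vk lk.
rewrite !mono2 rmorphB /= !grading_monomial -(eqv_alive g h).
case: ifP => [/and3P[au av _]|_]; last exact: subrr.
apply/eqP; rewrite subr_eq0; apply/eqP; congr 'X_[_]; apply/mnmP=> i.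
rewrite -[i]enum_valK !weight_sum /= !addn0; exact: feature_swap g uk vk au av.
Qed.

Lemma radical_move : radical_ideal move.
Proof.
pose bl m := blocks z F (cells m).
pose w m m' := if all (alive z F (bl m) (cells m)) (cells m')
               then Some (\sum_(c <- cells m') weight (bl m) c)%MM else None.
apply: (@radical_of_separating K _ _ move (fun m => rank z F (cells m))
          (fun m => grading (bl m) (cells m)) w).
- by move=> m m'; rewrite monomial_cells [LHS]grading_monomial /w; case: ifP.
- by move=> m p; apply: grading_move; exact: good_blocks.
- by move=> m; rewrite /w alive_self.
move=> m m' rmm'; rewrite /w alive_self; case: ifP => // al [e].
rewrite !monomial_cells; apply/eqv_ideal/eqv_blocks => // x.
by rewrite -!weight_sum e.
Qed.

End Moves.

(** * The change of coordinates *)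

Lemma big_distr_cell (K : comNzRingType) (n : nat) (a : 'I_n -> nat)
    (G : forall j, 'I_(a j) -> K) :
  \prod_j \sum_i G j i = \sum_(c : cell a) \prod_j G j (c j).
Proof.
have -> : \sum_(c : cell a) \prod_j G j (c j) =
    \sum_(f : fprod (fun j => 'I_(a j))) \prod_j [ffun i => G j i] (f j).
  rewrite (reindex (@dffun_of_fprod _ _)); last exact/onW_bij/dffun_of_fprod_bij.
  by apply: eq_bigr => f _; apply: eq_bigr => j _; rewrite !ffunE.
rewrite big_fprod -(bigA_distr_big_dep _ (fun j => untag 0 [ffun i => G j i])).
apply: eq_bigr => j _; transitivity (\sum_i [ffun i => G j i] i).
  by apply: eq_bigr => i _; rewrite ffunE.
exact: (big_tag (fun k => [ffun i => G k i])).
Qed.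

Section Tensors.

Variables (K : fieldType) (n : nat) (a : 'I_n -> nat).
Implicit Types (M P Q : forall j, 'I_(a j) -> 'I_(a j) -> K) (B : cell a -> polyR K a).
Implicit Types (c d u v : cell a) (J : {set 'I_n}).

(** The tensor product of the matrices [M j] applied to the table [B]. *)
Definition act M B u : polyR K a := \sum_(d : cell a) (\prod_j M j (u j) (d j)) *: B d.

Lemma act_comp P Q B u :
  act P (act Q B) u = act (fun j i k => \sum_m P j i m * Q j m k) B u.
Proof.
rewrite /act; under eq_bigr => d _ do rewrite scaler_sumr.
rewrite exchange_big; apply: eq_bigr => c _.
under eq_bigr => d _ do rewrite scalerA -big_split.
by rewrite -scaler_suml big_distr_cell.
Qed.

Lemma eq_act M P B u : (forall j k, M j (u j) k = P j (u j) k) -> act M B u = act P B u.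
Proof. by move=> e; apply: eq_bigr => d _; congr (_ *: _); apply: eq_bigr. Qed.

Lemma act_id B u : act (fun _ i k => (i == k)%:R) B u = B u.
Proof.
rewrite /act (bigD1 u) //= [X in X *: _]big1 ?scale1r; last by move=> j _; rewrite eqxx.
rewrite big1 ?addr0 // => d du.
have [j uj] : exists j, d j != u j.
  by apply/existsP; apply: contraNT du => /existsPn h; apply/eqP/ffunP=> j; apply/eqP/negbNE/h.
by rewrite (bigD1 j) //= eq_sym (negPf uj) mul0r scale0r.
Qed.

Lemma marginE J u : margin K J u =
  act (fun j i k => ((j \in J) ==> (i == k))%:R) (@xvar K n a) u.
Proof.
rewrite /margin /act big_mkcond; apply: eq_bigr => d _.
have [/forall_inP h|] := boolP [forall j in J, d j == u j].
  rewrite big1 ?scale1r // => j _; case: (boolP (j \in J)) => //= /h /eqP->.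
  by rewrite eqxx.
rewrite negb_forall => /existsP[j]; rewrite negb_imply => /andP[jJ dj].
by rewrite (bigD1 j) //= jJ /= eq_sym (negPf dj) mul0r scale0r.
Qed.

Definition minor l B u v := B u * B v - B (swap_coord l u v) * B (swap_coord l v u).

(* Exchanging the [l]-th entries of both index cells of the second product leaves the
   coefficients unchanged, so a minor of [act M B] is a combination of minors of [B]. *)
Lemma act_minor S M B l u v :
  (forall c d, \prod_j M j (u j) (c j) != 0 -> \prod_j M j (v j) (d j) != 0 ->
     ideal_gen S (minor l B c d)) ->
  ideal_gen S (minor l (act M B) u v).
Proof.
pose m (x y : cell a) := \prod_j M j (x j) (y j); move=> h.
have sq x y : act M B x * act M B y =
    \sum_(p : cell a * cell a) (m x p.1 * m y p.2) *: (B p.1 * B p.2).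
  rewrite /act big_distrlr /= pair_big /=; apply: eq_bigr => p _.
  by rewrite -scalerAl -scalerAr scalerA.
pose tw (p : cell a * cell a) := (swap_coord l p.1 p.2, swap_coord l p.2 p.1).
rewrite /minor !sq [X in _ - X](reindex_inj (h := tw)); last first.
  by apply: (can_inj (g := tw)) => -[x y]; rewrite /tw /= !swap_coordC.
rewrite -sumrB; apply: ideal_gen_sum => -[x y] _ /=.
have -> : m (swap_coord l u v) (swap_coord l x y) * m (swap_coord l v u) (swap_coord l y x) =
    m u x * m v y.
  rewrite -!big_split; apply: eq_bigr => j _ /=; rewrite !swap_coordE.
  by case: ifP => _; rewrite // mulrC.
rewrite -scalerBr -mul_mpolyC.
have [->|mu] := eqVneq (m u x) 0; first by rewrite mul0r mpolyC0 mul0r; exact: ideal_gen0.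
have [->|mv] := eqVneq (m v y) 0; first by rewrite mulr0 mpolyC0 mul0r; exact: ideal_gen0.
exact/ideal_genMl/h.
Qed.

Definition change M : polyR K a -> polyR K a :=
  comp_mpoly [tuple act M (@xvar K n a) (enum_val i) | i < #|cell a|].

HB.instance Definition _ M := GRing.LRMorphism.on (change M).

Lemma change_xvar M c : change M (xvar K c) = act M (@xvar K n a) c.
Proof. by rewrite /change /xvar comp_mpolyXU -tnth_nth tnth_mktuple enum_rankK. Qed.

Lemma change_act M P B u : change M (act P B u) = act P (change M \o B) u.
Proof. by rewrite /act raddf_sum; apply: eq_bigr => d _; exact: linearZZ. Qed.

End Tensors.

(** * Margins as new coordinates *)

Section Margins.

Variables (K : fieldType) (n : nat) (a : 'I_n -> nat) (z : cell a).
Implicit Types (c d u v : cell a) (J : {set 'I_n}).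

(** The base row is all ones and the others are those of the identity, so the tensor action sends
    the variable of [c] to the entry at [c] of the margin over [supp z c]. *)
Definition margin_mx j (i k : 'I_(a j)) : K := ((i == z j) || (i == k))%:R.

Definition unmargin_mx j (i k : 'I_(a j)) : K :=
  if i == z j then (if k == z j then 1 else -1) else (i == k)%:R.

Lemma unmarginK j (i k : 'I_(a j)) :
  \sum_m unmargin_mx i m * margin_mx m k = (i == k)%:R.
Proof.
rewrite (bigD1 i) //= /unmargin_mx /margin_mx; have [->|iz] /= := eqVneq i (z j).
  rewrite mulr1.
  under eq_bigr => m mz do rewrite (negPf mz) mulN1r /=.
  rewrite sumrN; have [<-|zk] := eqVneq (z j) k.
    by rewrite big1 ?subr0 // => m mz; rewrite (negPf mz).
  rewrite (bigD1 k) 1?eq_sym //= eqxx big1 ?addr0 ?subrr // => m /andP[_ mk].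
  by rewrite (negPf mk).
rewrite eqxx mul1r big1 ?addr0 // => m mi.
by rewrite eq_sym (negPf mi) mul0r.
Qed.

(** Summing over a coordinate thus becomes taking the base index there. *)
Lemma sum_unmargin j (k : 'I_(a j)) : \sum_i unmargin_mx i k = (k == z j)%:R.
Proof.
rewrite (bigD1 (z j)) //= /unmargin_mx eqxx; have [->|kz] := eqVneq k (z j).
  by rewrite big1 ?addr0 // => i iz; rewrite (negPf iz).
rewrite (bigD1 k) //= (negPf kz) ?eqxx big1 ?addr0 ?addNr // => i /andP[iz ik].
by rewrite (negPf iz) (negPf ik).
Qed.

Lemma change_unmarginK (f : polyR K a) : change margin_mx (change unmargin_mx f) = f.
Proof.
have hx c : change margin_mx (change unmargin_mx (xvar K c)) = xvar K c.
  rewrite change_xvar change_act -[RHS](act_id (@xvar K n a)).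
  transitivity (act unmargin_mx (act margin_mx (@xvar K n a)) c).
    by apply: eq_bigr => d _; rewrite /= change_xvar.
  by rewrite act_comp; apply: eq_act => j k; exact: unmarginK.
have scal M b (q : polyR K a) : change M (b *: q) = b *: change M q by exact: linearZZ.
rewrite {1}[f]mpolyE (raddf_sum (change unmargin_mx)) (raddf_sum (change margin_mx)).
rewrite [RHS]mpolyE; apply: eq_bigr => m _; rewrite /= !scal; congr (_ *: _).
rewrite monomial_cells /monomial.
rewrite (rmorph_prod (change unmargin_mx)) (rmorph_prod (change margin_mx)).
by apply: eq_bigr => c _; exact: hx.
Qed.

Variables (F : 'I_3 -> {set 'I_n}) (Delta : {set {set 'I_n}}).
Hypothesis FD : forall k, F k \in Delta.
Hypothesis DF : forall J, J \in Delta -> exists k, J \subset F k.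

(** In the new coordinates a margin over [J] involves only cells supported in a facet [F k]
    containing [J], so its minors are combinations of moves there. *)
Lemma unmargin_gens p : @IDelta_gens K n a Delta p ->
  ideal_gen (@move K n a z F) (change unmargin_mx p).
Proof.
move=> [J /DF[k /subsetP Jk] [u [v [l [lJ ->]]]]].
pose N j (i m : 'I_(a j)) : K := \sum_q ((j \in J) ==> (i == q))%:R * unmargin_mx q m.
have hm w : change unmargin_mx (margin K J w) = act N (@xvar K n a) w.
  rewrite marginE change_act -act_comp; apply: eq_bigr => d _.
  by rewrite /= change_xvar.
have hN w c : \prod_j N j (w j) (c j) != 0 -> supp z c \subset F k.
  move=> /prodf_neq0 h; apply/suppP=> j jk; have := h j isT.
  have jJ : j \notin J by apply: contra jk => /Jk.
  rewrite /N; under eq_bigr do rewrite (negPf jJ) mul1r.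
  by rewrite sum_unmargin; have [|_] := eqVneq (c j) (z j); rewrite /= ?eqxx.
rewrite rmorphB !rmorphM /= !hm; apply: act_minor => c d /hN ck /hN dk.
by apply: ideal_gen_mem; exists k, l, c, d; split=> //; exact: Jk.
Qed.

Lemma margin_gens p : @move K n a z F p ->
  ideal_gen (@IDelta_gens K n a Delta) (change margin_mx p).
Proof.
move=> [k [l [u [v [uk vk lk ->]]]]].
(* The margin over [F k] ignores the index outside [F k], and [N] picks the base index there. *)
pose N j (i m : 'I_(a j)) : K := if j \in F k then margin_mx i m else (m == z j)%:R.
have hm w : supp z w \subset F k ->
    change margin_mx (xvar K w) = act N (margin K (F k)) w.
  move=> /suppP wk; rewrite change_xvar.
  transitivity (act N (act (fun j i m => ((j \in F k) ==> (i == m))%:R) (@xvar K n a)) w).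
    rewrite act_comp; apply: eq_act => j i; rewrite /N.
    have [jk|jk] /= := boolP (j \in F k).
      rewrite (bigD1 i) //= eqxx mulr1 big1 ?addr0 // => m mi.
      by rewrite (negPf mi) mulr0.
    rewrite /margin_mx wk // eqxx (bigD1 (z j)) //= eqxx mulr1 big1 ?addr0 // => m mz.
    by rewrite (negPf mz) mul0r.
  by apply: eq_bigr => d _; rewrite marginE.
rewrite rmorphB !rmorphM /= !hm ?supp_swap2 //; apply: act_minor => c d _ _.
by apply: ideal_gen_mem; apply: (ex_intro2 _ _ (F k) (FD k)); exists c, d, l.
Qed.

(** The two substitutions carry each ideal into the other, and [change_unmarginK] leads back to
    [f]. *)
Lemma radical_IDelta : radical_ideal (@IDelta_gens K n a Delta).
Proof.
move=> f k /(ideal_gen_morph (f := change unmargin_mx) unmargin_gens).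
rewrite rmorphXn => /radical_move.
move=> /(ideal_gen_morph (f := change margin_mx) margin_gens).
by rewrite /= change_unmarginK.
Qed.

End Margins.

Lemma facets_cover n (Delta : {set {set 'I_n}}) :
  Delta != set0 -> (#|facets Delta| <= 3)%N ->
  exists F : 'I_3 -> {set 'I_n}, (forall k, F k \in Delta) /\
    (forall J, J \in Delta -> exists k, J \subset F k).
Proof.
move=> /set0Pn[J0 J0D] card3.
(* [J0] fills the positions beyond the number of facets. *)
exists (fun k => nth J0 (enum (facets Delta)) k); split=> [k|J JD].
  have [lt|ge] := ltnP k (size (enum (facets Delta))); last by rewrite nth_default.
  by have := mem_nth J0 lt; rewrite mem_enum inE => /andP[].
have J_ok : (J \in Delta) && (J \subset J) by rewrite JD /=.
case: (@arg_maxnP _ J (fun G => (G \in Delta) && (J \subset G)) (fun G => #|G|) J_ok).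
move=> G /andP[GD JG] Gmax.
have GF : G \in enum (facets Delta).
  rewrite mem_enum inE GD; apply/forall_inP=> H HD; apply/implyP=> GH.
  by rewrite eq_sym eqEcard GH; apply: Gmax; rewrite HD (subset_trans JG GH).
have lt3 : (index G (enum (facets Delta)) < 3)%N.
  by rewrite (leq_trans _ card3) // cardE index_mem.
by exists (Ordinal lt3); rewrite nth_index.
Qed.

Local Close Scope ring_scope.

Theorem theorem7p8 (K : fieldType) (n : nat) (a : 'I_n -> nat)
  (Delta : {set {set 'I_n}}) :
  simplicial_complex Delta ->
  #|facets Delta| <= 3 ->
  radical_ideal (@IDelta_gens K n a Delta).
Proof.
move=> [D0 _] card3; have [F [FD DF]] := facets_cover D0 card3.
have [z _|no_cell] := pickP [pred c : cell a | true].
  exact: (radical_IDelta z FD DF).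
(* Without cells there are no minors, so the ideal is zero, and a polynomial ring over a field has
   no nonzero nilpotent. *)
have gens0 p : @IDelta_gens K n a Delta p -> p = 0%R.
  by move=> [J _ [u]]; have := no_cell u.
move=> f k [s [hs /eqP]]; rewrite big_seq big1 => [|x /hs/gens0 ->]; last by rewrite mulr0.
rewrite expf_eq0 => /andP[_ /eqP ->]; exact: ideal_gen0.
Qed.
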